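(* For every integer $k \geq 0$ and real $x$, the Daehee polynomials of the first and second kind satisfy \[ D_k(x) = k!\,\frac{\mathrm{d}}{\mathrm{d}x}\binom{x}{k+1} \qquad\text{and}\qquad \widehat{D}_k(x) = k!\,\frac{\mathrm{d}}{\mathrm{d}x}\binom{x+k-1}{k+1}. \]
   Context: The Daehee polynomials of the first kind $D_k(x)$ are defined by the generating function $\sum_{k\ge 0} D_k(x)\frac{t^k}{k!} = \frac{\ln(1+t)}{t}(1+t)^x$. The Daehee polynomials of the second kind $\widehat{D}_k(x)$ are defined by $\sum_{k\ge 0} \widehat{D}_k(x)\frac{t^k}{k!} = \frac{\ln(1-t)}{-t}(1-t)^{1-x}$. For real $x$ and integer $m\ge 0$, the generalized binomial coefficient is $\binom{x}{m} = \frac{x(x-1)\cdots(x-m+1)}{m!}$ for $m\ge1$ and $\binom{x}{0}=1$; it is a polynomial in $x$, and $\frac{\mathrm{d}}{\mathrm{d}x}$ denotes its derivative with respect to $x$. *)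

(* Defs.v *)
From Stdlib Require Import Reals Factorial ClassicalEpsilon.
From Coquelicot Require Import Coquelicot.
Open Scope R_scope.

(* The neighbourhood of 0 is punctured: the generating functions below contain
   a division by t, and have a removable singularity at t = 0. *)
Definition is_egf (a : nat -> R) (f : R -> R) : Prop :=
  locally' 0 (fun t : R => is_series (fun k => a k * (t ^ k / INR (fact k))) (f t)).

(* The choice is only from a singleton: the coefficients of a convergent power
   series are determined by its sum near 0. *)
Definition egf_coeff (f : R -> R) : nat -> R :=
  epsilon (inhabits (fun _ : nat => 0)) (fun a => is_egf a f).

Definition daehee1 (k : nat) (x : R) : R :=
  egf_coeff (fun t => ln (1 + t) / t * Rpower (1 + t) x) k.

Definition daehee2 (k : nat) (x : R) : R :=
  egf_coeff (fun t => ln (1 - t) / (- t) * Rpower (1 - t) (1 - x)) k.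

(* x (x - 1) ... (x - m + 1) *)
Fixpoint falling (x : R) (m : nat) : R :=
  match m with
  | O => 1
  | S m' => falling x m' * (x - INR m')
  end.

Definition gbinom (x : R) (m : nat) : R := falling x m / INR (fact m).

(* Main.v *)
Require Import Defs.
From Stdlib Require Import Reals Factorial Lra Lia ClassicalEpsilon.
From Coquelicot Require Import Coquelicot.
Open Scope R_scope.

(** Let [b m] be the binomial coefficient [gbinom x m] and [c m] its derivative
    in [x].  Differentiating [(m+1) b (m+1) = (x-m) b m] gives
    [(m+1) c (m+1) = (x-m) c m + b m], so the generating functions [B] and [C]
    satisfy [(1+t) B' = x B] and [(1+t) C' = x C + B] near [0].  Hence
    [B = (1+t)^x] and [C = ln (1+t) (1+t)^x]; since [c 0 = 0], dividing by [t]
    gives the first formula.  The second one is the first one at [(-t, 1-x)],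
    by the reflection of the falling factorial. *)

(** * Recurrences and reflection for binomial coefficients and their derivatives *)

Lemma gbinom_S (x : R) (m : nat) :
  INR (S m) * gbinom x (S m) = (x - INR m) * gbinom x m.
Proof.
  unfold gbinom; cbn [falling].
  rewrite fact_simpl, mult_INR.
  field; split; [apply INR_fact_neq_0 | now apply not_0_INR].
Qed.

Lemma ex_derive_gbinom (x : R) (m : nat) : ex_derive (fun y => gbinom y m) x.
Proof.
  unfold gbinom.
  assert (H : ex_derive (fun y => falling y m) x).
  { induction m as [|m IH]; cbn [falling].
    - apply ex_derive_const.
    - apply ex_derive_mult; [exact IH | auto_derive; trivial]. }
  now apply (ex_derive_scal_l (fun y => falling y m) x (/ INR (fact m))).
Qed.

Definition dgbinom (x : R) (m : nat) : R := Derive (fun y => gbinom y m) x.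

Lemma is_derive_gbinom (x : R) (m : nat) :
  is_derive (fun y => gbinom y m) x (dgbinom x m).
Proof. apply Derive_correct, ex_derive_gbinom. Qed.

Lemma dgbinom_0 (x : R) : dgbinom x 0 = 0.
(* [gbinom y 0] does not depend on [y], so it is convertible with the constant [gbinom 0 0]. *)
Proof. exact (Derive_const (gbinom 0 0) x). Qed.

Lemma dgbinom_S (x : R) (m : nat) :
  INR (S m) * dgbinom x (S m) = (x - INR m) * dgbinom x m + gbinom x m.
Proof.
  unfold dgbinom at 1.
  rewrite <- Derive_scal.
  rewrite (Derive_ext _ (fun y => (y - INR m) * gbinom y m))
    by (intro; apply gbinom_S).
  apply is_derive_unique.
  evar_last.
  - apply (is_derive_mult (fun y => y - INR m) (fun y => gbinom y m)).
    + auto_derive; [trivial | reflexivity].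
    + apply is_derive_gbinom.
    + intros; apply Rmult_comm.
  - unfold plus, mult; simpl; ring.
Qed.

Lemma falling_shift (x : R) (m : nat) :
  falling (x + 1) (S m) = (x + 1) * falling x m.
Proof.
  induction m as [|m IH]; [simpl; ring|].
  change (falling (x + 1) (S m) * (x + 1 - INR (S m)) =
          (x + 1) * (falling x m * (x - INR m))).
  rewrite IH, S_INR; ring.
Qed.

(** The factors [x + m - 1, ..., x] are the negated factors of [falling (- x) m], in reverse order;
    the induction therefore peels off the largest factor, by [falling_shift]. *)
Lemma falling_reflect (x : R) (m : nat) :
  falling (x + INR m - 1) m = (-1) ^ m * falling (- x) m.
Proof.
  induction m as [|m IH]; [simpl; ring|].
  replace (x + INR (S m) - 1) with (x + INR m - 1 + 1) by (rewrite S_INR; ring).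
  rewrite falling_shift, IH; simpl; ring.
Qed.

(** Reflection gives the sign [(-1) ^ (k + 1)], and the chain rule for [1 - y] contributes one more,
    leaving [(-1) ^ k]. *)
Lemma Derive_gbinom_reflect (x : R) (k : nat) :
  Derive (fun y => gbinom (y + INR k - 1) (k + 1)) x =
  (-1) ^ k * dgbinom (1 - x) (S k).
Proof.
  rewrite (Derive_ext _ (fun y => (-1) ^ S k * gbinom (1 - y) (S k))).
  - rewrite Derive_scal.
    rewrite (Derive_comp (fun y => gbinom y (S k)) (fun y => 1 - y));
      [| apply ex_derive_gbinom | auto_derive; trivial].
    replace (Derive (fun y => 1 - y) x) with (- 1).
    + unfold dgbinom; simpl; ring.
    + symmetry; apply is_derive_unique; auto_derive; [trivial | ring].
  - intro y; rewrite Nat.add_1_r; unfold gbinom.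
    replace (y + INR k - 1) with (y - 1 + INR (S k) - 1) by (rewrite S_INR; ring).
    rewrite falling_reflect.
    replace (- (y - 1)) with (1 - y) by ring.
    unfold Rdiv; ring.
Qed.

(** * Geometric growth bounds and radii of convergence *)

Lemma gbinom_ratio_bound (x : R) (m : nat) :
  Rabs (x - INR m) <= INR (S m) * (Rabs x + 1).
Proof.
  apply Rle_trans with (Rabs x + INR m).
  - unfold Rminus; eapply Rle_trans; [apply Rabs_triang|].
    rewrite Rabs_Ropp, (Rabs_pos_eq (INR m)) by apply pos_INR; lra.
  - rewrite S_INR; pose proof (pos_INR m); pose proof (Rabs_pos x); nra.
Qed.

Lemma gbinom_bound (x : R) (m : nat) : Rabs (gbinom x m) <= (Rabs x + 1) ^ m.
Proof.
  induction m as [|m IH].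
  - unfold gbinom; simpl; rewrite Rdiv_1_r, Rabs_R1; lra.
  - assert (Hm : 0 < INR (S m)) by (apply lt_0_INR; lia).
    apply Rmult_le_reg_l with (1 := Hm).
    rewrite <- (Rabs_pos_eq (INR (S m))) at 1 by lra.
    rewrite <- Rabs_mult, gbinom_S, Rabs_mult.
    change ((Rabs x + 1) ^ S m) with ((Rabs x + 1) * (Rabs x + 1) ^ m).
    rewrite <- Rmult_assoc.
    apply Rmult_le_compat; try apply Rabs_pos; auto using gbinom_ratio_bound.
Qed.

(** The base exceeds that of [gbinom_bound] by one to absorb the inhomogeneous term of [dgbinom_S]:
    with [M = |x| + 2], [(|x| + 1) M ^ m + M ^ m = M ^ (m + 1)]. *)
Lemma dgbinom_bound (x : R) (m : nat) : Rabs (dgbinom x m) <= (Rabs x + 2) ^ m.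
Proof.
  induction m as [|m IH].
  - rewrite dgbinom_0, Rabs_R0; simpl; lra.
  - assert (Hm : 1 <= INR (S m)) by (rewrite S_INR; pose proof (pos_INR m); lra).
    apply Rmult_le_reg_l with (INR (S m)); [lra|].
    rewrite <- (Rabs_pos_eq (INR (S m))) at 1 by lra.
    rewrite <- Rabs_mult, dgbinom_S.
    eapply Rle_trans; [apply Rabs_triang|].
    rewrite Rabs_mult.
    assert (H1 : Rabs (x - INR m) * Rabs (dgbinom x m) <=
                 INR (S m) * (Rabs x + 1) * (Rabs x + 2) ^ m)
      by (apply Rmult_le_compat; try apply Rabs_pos; auto using gbinom_ratio_bound).
    assert (H2 : Rabs (gbinom x m) <= (Rabs x + 2) ^ m).
    { eapply Rle_trans; [apply gbinom_bound|].
      apply pow_incr; pose proof (Rabs_pos x); lra. }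
    assert (H3 : 0 <= (Rabs x + 2) ^ m)
      by (apply pow_le; pose proof (Rabs_pos x); lra).
    simpl pow; nra.
Qed.

Lemma CV_radius_geometric (a : nat -> R) (M t : R) :
  0 < M -> (forall m, Rabs (a m) <= M ^ m) -> Rabs t < / M ->
  Rbar_lt (Rabs t) (CV_radius a).
Proof.
  intros HM Ha Ht.
  apply Rbar_lt_le_trans with (/ M); [exact Ht|].
  apply (proj1 (CV_radius_bounded a)).
  exists 1; intro n.
  rewrite Rabs_mult, <- RPow_abs, (Rabs_pos_eq (/ M))
    by (left; now apply Rinv_0_lt_compat).
  apply Rle_trans with (M ^ n * (/ M) ^ n).
  - apply Rmult_le_compat_r; [apply pow_le; left; now apply Rinv_0_lt_compat | apply Ha].
  - rewrite <- Rpow_mult_distr, Rinv_r, pow1 by lra; lra.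
Qed.

(** * Differential equations of the two series and their solutions *)

Lemma PSeries_binomial_ode (a g : nat -> R) (x t : R) :
  (forall m, INR (S m) * a (S m) = (x - INR m) * a m + g m) ->
  Rbar_lt (Rabs t) (CV_radius a) -> Rbar_lt (Rabs t) (CV_radius g) ->
  (1 + t) * PSeries (PS_derive a) t = x * PSeries a t + PSeries g t.
Proof.
  intros Hrec Ha Hg.
  assert (Hd : ex_pseries (PS_derive a) t)
    by (apply CV_radius_inside; now rewrite CV_radius_derive).
  assert (Hi : ex_pseries (PS_incr_1 (PS_derive a)) t)
    by (apply CV_radius_inside; now rewrite CV_radius_incr_1, CV_radius_derive).
  rewrite Rmult_plus_distr_r, Rmult_1_l, <- PSeries_incr_1, <- PSeries_plus by assumption.
  rewrite <- PSeries_scal, <- PSeries_plus.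
  (* The coefficient of [t ^ m] on the left is [(m + 1) a (m + 1) + m a m], so the equation is
     [Hrec] with [m a m] moved across. *)
  - apply PSeries_ext; intro m.
    unfold PS_plus, PS_scal, PS_derive, plus, scal; simpl.
    unfold mult; simpl.
    specialize (Hrec m).
    (* The shifted series has coefficient [zero] at [m = 0], which is [m a m] there. *)
    destruct m as [|m]; unfold PS_incr_1, zero; simpl in *; lra.
  - apply ex_pseries_scal; [apply Rmult_comm | now apply CV_radius_inside].
  - now apply CV_radius_inside.
Qed.

Lemma is_derive_0_eq_at_0 (h : R -> R) (r t : R) :
  (forall s, Rabs s < r -> is_derive h s 0) -> Rabs t < r -> h t = h 0.
Proof.
  intros Hh Ht.
  destruct (Rtotal_order t 0) as [Hneg | [-> | Hpos]]; trivial.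
  - apply (eq_is_derive (V := R_NormedModule)); trivial.
    intros s Hs; apply Hh; revert Ht; split_Rabs; lra.
  - symmetry; apply (eq_is_derive (V := R_NormedModule)); trivial.
    intros s Hs; apply Hh; revert Ht; split_Rabs; lra.
Qed.

(** Multiplying by [(1 + s) ^ (- x)] cancels the term [x F], so only the contribution of [G] is left
    to integrate. *)
Lemma is_derive_integrating_factor (F : R -> R) (F' G x t : R) :
  0 < 1 + t -> is_derive F t F' -> (1 + t) * F' = x * F t + G ->
  is_derive (fun s => F s * Rpower (1 + s) (- x)) t
    (G * Rpower (1 + t) (- x) / (1 + t)).
Proof.
  intros Ht HF Hode.
  evar_last.
  - apply (is_derive_mult F (fun s => Rpower (1 + s) (- x)) t F');
      [exact HF | | intros; apply Rmult_comm].
    unfold Rpower; auto_derive; [exact Ht | reflexivity].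
  - unfold plus, mult; simpl; fold (Rpower (1 + t) (- x)).
    replace G with ((1 + t) * F' - x * F t) by lra.
    field; lra.
Qed.

Lemma Rpower_opp_cancel (u v x y : R) :
  u * Rpower v (- x) = y -> u = y * Rpower v x.
Proof.
  intros <-.
  rewrite Rmult_assoc, <- Rpower_plus, Rplus_opp_l.
  unfold Rpower; rewrite Rmult_0_l, exp_0; ring.
Qed.

Lemma CV_radius_dgbinom (x t : R) :
  Rabs t < / (Rabs x + 2) -> Rbar_lt (Rabs t) (CV_radius (dgbinom x)).
Proof.
  intro small_t.
  apply CV_radius_geometric with (Rabs x + 2); trivial.
  - pose proof (Rabs_pos x); lra.
  - apply dgbinom_bound.
Qed.

(** The bound on [t] is stricter than [gbinom_bound] requires, so that both series share one
    disk. *)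
Lemma CV_radius_gbinom (x t : R) :
  Rabs t < / (Rabs x + 2) -> Rbar_lt (Rabs t) (CV_radius (gbinom x)).
Proof.
  intro small_t.
  pose proof (Rabs_pos x).
  apply CV_radius_geometric with (Rabs x + 1).
  - lra.
  - apply gbinom_bound.
  - apply Rlt_trans with (1 := small_t), Rinv_lt_contravar; nra.
Qed.

(** Keeps [ln (1 + t)] and [Rpower (1 + t)] away from the default values of [ln]. *)
Lemma one_plus_pos (x t : R) : Rabs t < / (Rabs x + 2) -> 0 < 1 + t.
Proof.
  intro small_t.
  assert (/ (Rabs x + 2) < 1).
  { rewrite <- Rinv_1; apply Rinv_lt_contravar; pose proof (Rabs_pos x); lra. }
  revert small_t; split_Rabs; lra.
Qed.

Lemma PSeries_gbinom (x t : R) :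
  Rabs t < / (Rabs x + 2) -> PSeries (gbinom x) t = Rpower (1 + t) x.
Proof.
  intro Ht.
  rewrite <- (Rmult_1_l (Rpower _ _)).
  apply Rpower_opp_cancel.
  rewrite (is_derive_0_eq_at_0
             (fun s => PSeries (gbinom x) s * Rpower (1 + s) (- x)) _ t) with (2 := Ht).
  - rewrite PSeries_0, Rplus_0_r.
    unfold gbinom, Rpower; rewrite ln_1, Rmult_0_r, exp_0; simpl; field.
  - intros s Hs.
    evar_last.
    + eapply is_derive_integrating_factor with (G := 0).
      * now apply one_plus_pos with x.
      * now apply is_derive_PSeries, CV_radius_gbinom.
      (* The homogeneous equation is the case where [g] is the zero sequence. *)
      * rewrite <- (PSeries_const_0 s).
        apply PSeries_binomial_ode.
        -- intro m; rewrite gbinom_S; ring.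
        -- now apply CV_radius_gbinom.
        -- now rewrite CV_radius_const_0.
    + unfold Rdiv; ring.
Qed.

(** Here [G] is [(1 + s) ^ x], so the product with the integrating factor has derivative
    [1 / (1 + s)], the same as [ln (1 + s)]; both vanish at [0]. *)
Lemma PSeries_dgbinom (x t : R) :
  Rabs t < / (Rabs x + 2) ->
  PSeries (dgbinom x) t = ln (1 + t) * Rpower (1 + t) x.
Proof.
  intro Ht.
  apply Rpower_opp_cancel.
  apply Rminus_diag_uniq.
  rewrite (is_derive_0_eq_at_0
             (fun s => PSeries (dgbinom x) s * Rpower (1 + s) (- x) - ln (1 + s)) _ t)
    with (2 := Ht).
  - rewrite PSeries_0, dgbinom_0, Rplus_0_r, ln_1; ring.
  - intros s Hs.
    pose proof (one_plus_pos _ _ Hs).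
    evar_last.
    + apply (is_derive_minus (V := R_NormedModule)).
      * eapply is_derive_integrating_factor; [assumption | | ].
        -- now apply is_derive_PSeries, CV_radius_dgbinom.
        -- apply PSeries_binomial_ode with (g := gbinom x).
           ++ apply dgbinom_S.
           ++ now apply CV_radius_dgbinom.
           ++ now apply CV_radius_gbinom.
      * auto_derive; [assumption | reflexivity].
    + rewrite PSeries_gbinom, <- Rpower_plus, Rplus_opp_r by assumption.
      unfold Rpower, minus, plus, opp; simpl.
      rewrite Rmult_0_l, exp_0; field; lra.
Qed.

(** * Exponential generating functions with the claimed coefficients *)

Lemma is_series_dgbinom (x t : R) :
  Rabs t < / (Rabs x + 2) -> t <> 0 ->
  is_series (fun k => dgbinom x (S k) * t ^ k) (ln (1 + t) / t * Rpower (1 + t) x).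
Proof.
  intros Ht Ht0.
  (* Dropping the constant term, which is [0], and shifting amounts to dividing by [t]. *)
  apply (is_pseries_R (PS_decr_1 (dgbinom x))).
  evar_last.
  - apply (is_pseries_decr_1 (dgbinom x) t (/ t)).
    + now apply Rinv_l.
    + apply PSeries_correct, CV_radius_inside, CV_radius_dgbinom, Ht.
  - rewrite PSeries_dgbinom, dgbinom_0 by assumption.
    unfold scal, plus, opp; simpl; unfold mult; simpl; field; exact Ht0.
Qed.

Lemma locally'_0_Rabs_lt (r : R) (P : R -> Prop) :
  0 < r -> (forall t, Rabs t < r -> t <> 0 -> P t) -> locally' 0 P.
Proof.
  intros Hr HP.
  exists (mkposreal r Hr); intros t Ht Ht0.
  apply HP; trivial.
  unfold ball in Ht; simpl in Ht; unfold AbsRing_ball, abs, minus, plus, opp in Ht.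
  simpl in Ht; now rewrite Ropp_0, Rplus_0_r in Ht.
Qed.

Lemma is_egf_daehee1 (x : R) :
  is_egf (fun k => INR (fact k) * dgbinom x (S k))
    (fun t => ln (1 + t) / t * Rpower (1 + t) x).
Proof.
  apply locally'_0_Rabs_lt with (/ (Rabs x + 2)).
  - apply Rinv_0_lt_compat; pose proof (Rabs_pos x); lra.
  - intros t Ht Ht0.
    apply is_series_ext with (2 := is_series_dgbinom x t Ht Ht0).
    intro k; simpl; field; apply INR_fact_neq_0.
Qed.

Lemma is_egf_daehee2 (x : R) :
  is_egf (fun k => INR (fact k) * ((-1) ^ k * dgbinom (1 - x) (S k)))
    (fun t => ln (1 - t) / (- t) * Rpower (1 - t) (1 - x)).
Proof.
  apply locally'_0_Rabs_lt with (/ (Rabs (1 - x) + 2)).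
  - apply Rinv_0_lt_compat; pose proof (Rabs_pos (1 - x)); lra.
  - intros t Ht Ht0.
    rewrite <- Rabs_Ropp in Ht.
    assert (Ht0' : - t <> 0) by lra.
    apply is_series_ext with (2 := is_series_dgbinom (1 - x) (- t) Ht Ht0').
    intro k; simpl.
    (* The sign [(-1) ^ k] comes out of [(- t) ^ k]. *)
    replace (- t) with (-1 * t) by ring.
    rewrite Rpow_mult_distr; field; apply INR_fact_neq_0.
Qed.

(** * Uniqueness of the coefficients *)

Lemma is_egf_pseries (a : nat -> R) (f : R -> R) :
  is_egf a f -> locally' 0 (fun t => is_pseries (fun k => a k / INR (fact k)) t (f t)).
Proof.
  unfold is_egf; apply filter_imp; intros t Ht.
  apply is_pseries_R, is_series_ext with (2 := Ht).
  intro k; simpl; unfold Rdiv; ring.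
Qed.

(** One nonzero point of convergence suffices: the terms tend to [0] there, which fails strictly
    outside the disk of convergence. *)
Lemma CV_radius_gt_0_of_locally' (a : nat -> R) :
  locally' 0 (fun t => ex_pseries a t) -> Rbar_lt 0 (CV_radius a).
Proof.
  intros [e He].
  set (t := e / 2).
  assert (Ht : 0 < t) by (unfold t; pose proof (cond_pos e); lra).
  apply Rbar_lt_le_trans with (Rabs t); [simpl; rewrite Rabs_pos_eq; lra|].
  apply Rbar_not_lt_le; intro Hlt.
  apply (CV_disk_outside _ _ Hlt), ex_series_lim_0, ex_pseries_R, He; [|lra].
  unfold ball; simpl; unfold AbsRing_ball, abs, minus, plus, opp; simpl.
  rewrite Ropp_0, Rplus_0_r, Rabs_pos_eq by lra.
  unfold t; pose proof (cond_pos e); lra.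
Qed.

Lemma is_egf_unique (a b : nat -> R) (f : R -> R) :
  is_egf a f -> is_egf b f -> forall k, a k = b k.
Proof.
  intros Ha Hb k.
  apply is_egf_pseries in Ha, Hb.
  set (a' := fun k => a k / INR (fact k)) in *.
  set (b' := fun k => b k / INR (fact k)) in *.
  assert (E : a' k = b' k).
  { (* The factor [t] of the shifted series makes them agree at [0] as well. *)
    change (PS_incr_1 a' (S k) = PS_incr_1 b' (S k)).
    apply PSeries_ext_recip.
    - rewrite CV_radius_incr_1; apply CV_radius_gt_0_of_locally'.
      revert Ha; apply filter_imp; intros t Ht; now exists (f t).
    - rewrite CV_radius_incr_1; apply CV_radius_gt_0_of_locally'.
      revert Hb; apply filter_imp; intros t Ht; now exists (f t).
    - unfold locally', within in Ha, Hb.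
      generalize (filter_and _ _ Ha Hb); apply filter_imp; intros t [Hat Hbt].
      rewrite !PSeries_incr_1.
      destruct (Req_dec t 0) as [-> | Ht]; [ring|].
      now rewrite (is_pseries_unique _ _ _ (Hat Ht)), (is_pseries_unique _ _ _ (Hbt Ht)). }
  unfold a', b' in E.
  apply Rmult_eq_reg_r with (/ INR (fact k)); [exact E|].
  apply Rinv_neq_0_compat, INR_fact_neq_0.
Qed.

(** Exhibiting one sequence [a] makes the choice by [epsilon] meaningful, and uniqueness identifies
    the chosen sequence with [a]. *)
Lemma egf_coeff_eq (a : nat -> R) (f : R -> R) (k : nat) :
  is_egf a f -> egf_coeff f k = a k.
Proof.
  intro Ha; apply is_egf_unique with f; [|exact Ha].
  unfold egf_coeff; apply epsilon_spec; now exists a.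
Qed.

Theorem theorem1 (k : nat) (x : R) :
  daehee1 k x = INR (fact k) * Derive (fun y : R => gbinom y (k + 1)) x /\
  daehee2 k x = INR (fact k) * Derive (fun y : R => gbinom (y + INR k - 1) (k + 1)) x.
Proof.
  split.
  - rewrite Nat.add_1_r.
    exact (egf_coeff_eq _ _ k (is_egf_daehee1 x)).
  - rewrite Derive_gbinom_reflect.
    exact (egf_coeff_eq _ _ k (is_egf_daehee2 x)).
Qed.
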